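(* Let $\beta$ be a non-empty permutation and let $\pi=2413\circledcirc\beta$. Then \[ \mu[1,\pi]=\begin{cases} 4 & \text{if } \beta=1,\\ -6 & \text{if } \beta=2413,\\ 2\,\mu[1,\beta] & \text{if } \beta \text{ is a 2413-balloon},\\ \mu[1,\beta] & \text{otherwise.} \end{cases} \]
   Context: Permutations are written in one-line notation, and $|\pi|$ denotes the length of $\pi$. A permutation $\sigma=\sigma_1\cdots\sigma_m$ is contained in $\pi=\pi_1\cdots\pi_n$, written $\sigma\le\pi$, if there are indices $1\le i_1<\dots<i_m\le n$ such that for all $r,s\in\{1,\dots,m\}$, $\pi_{i_r}<\pi_{i_s}$ if and only if $\sigma_r<\sigma_s$. The set of all (non-empty) permutations of all lengths is a poset under $\le$. The Möbius function on this poset is defined by: $\mu[\sigma,\pi]=0$ if $\sigma\nleq\pi$; $\mu[\pi,\pi]=1$; and for $\sigma<\pi$, $\mu[\sigma,\pi]=-\sum_{\sigma\le\lambda<\pi}\mu[\sigma,\lambda]$. In $\mu[1,\pi]$, the symbol $1$ is the permutation of length 1. For a non-empty permutation $\beta$, the 2413-balloon of $\beta$, written $2413\circledcirc\beta$, is the permutation of length $|\beta|+4$ given by $(2413\circledcirc\beta)_1=2$; $(2413\circledcirc\beta)_2=|\beta|+4$; $(2413\circledcirc\beta)_i=\beta_{i-2}+2$ for $2<i\le|\beta|+2$; $(2413\circledcirc\beta)_{|\beta|+3}=1$; $(2413\circledcirc\beta)_{|\beta|+4}=|\beta|+3$. A permutation is called a 2413-balloon if it equals $2413\circledcirc\gamma$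 for some non-empty permutation $\gamma$ (so $2413$ itself is not a 2413-balloon). *)

(* Defs.v *)
From mathcomp Require Import all_boot all_order all_algebra.

Set Implicit Arguments.
Unset Strict Implicit.
Unset Printing Implicit Defensive.

Import GRing.Theory.
Local Open Scope ring_scope.

(* A permutation of length n is its one-line notation, a word on 1, ..., n.
   Values are 1-based; positions in the word are 0-based. *)
Definition is_perm (s : seq nat) : bool :=
  (s != [::]) && perm_eq s (iota 1 (size s)).

Definition perms (n : nat) : seq (seq nat) := permutations (iota 1 n).

Definition contained (sigma pi : seq nat) : bool :=
  [exists f : {ffun 'I_(size sigma) -> 'I_(size pi)},
    [forall r : 'I_(size sigma), forall s : 'I_(size sigma),
      (r < s)%N ==> (f r < f s)%N] &&
    [forall r : 'I_(size sigma), forall s : 'I_(size sigma),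
      (nth 0%N pi (f r) < nth 0%N pi (f s))%N ==
      (nth 0%N sigma r < nth 0%N sigma s)%N]].

Definition strictly_contained (sigma pi : seq nat) : bool :=
  contained sigma pi && (sigma != pi).

(* Strict containment decreases the length, so recursion depth [size pi] is
   enough: the defining equations are [mobius_ncontained], [mobius_id] and
   [mobius_lt] below.  The sum runs over permutations of length at most
   [size pi], which includes everything contained in [pi]. *)
Fixpoint mobius_rec (k : nat) (sigma pi : seq nat) : int :=
  if k is k'.+1 then
    if ~~ contained sigma pi then 0
    else if sigma == pi then 1
    else - \sum_(1 <= n < (size pi).+1)
             \sum_(lambda <- perms n |
                     contained sigma lambda && strictly_contained lambda pi)
               mobius_rec k' sigma lambda
  else 0.

Definition mobius (sigma pi : seq nat) : int := mobius_rec (size pi) sigma pi.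

Definition balloon2413 (beta : seq nat) : seq nat :=
  [:: 2; size beta + 4]%N ++ [seq (b + 2)%N | b <- beta]
    ++ [:: 1; size beta + 3]%N.

Definition is_balloon2413 (beta : seq nat) : Prop :=
  exists gamma : seq nat, is_perm gamma /\ beta = balloon2413 gamma.

Lemma mem_perms (n : nat) (s : seq nat) :
  (0 < n)%N -> (s \in perms n) = is_perm s && (size s == n).
Proof.
move=> n_gt0; rewrite mem_permutations /is_perm.
apply/idP/idP => [ps | /andP[/andP[_ ps] /eqP <-]] //.
have sz : size s = n by rewrite (perm_size ps) size_iota.
by rewrite sz ps eqxx -size_eq0 sz -lt0n n_gt0.
Qed.

Lemma size_contained (sigma pi : seq nat) :
  contained sigma pi -> (size sigma <= size pi)%N.
Proof.
case/existsP=> f /andP[/forallP fmono _].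
have f_inj : injective f.
  move=> r s frs; apply/val_inj; case: (ltngtP r s) => // rs.
    by have := forallP (fmono r) s; rewrite rs frs ltnn.
  by have := forallP (fmono s) r; rewrite rs frs ltnn.
by have := leq_card f f_inj; rewrite !card_ord.
Qed.

Lemma nth_is_perm (s : seq nat) (i : nat) : is_perm s -> (i < size s)%N ->
  nth 0%N s i = (count (fun j => nth 0 s j < nth 0 s i)%N (iota 0 (size s))).+1.
Proof.
case/andP=> _ ps lt_i.
have : nth 0%N s i \in iota 1 (size s) by rewrite -(perm_mem ps) mem_nth.
rewrite mem_iota; set v := nth 0%N s i => /andP[v_gt0 v_le].
have -> : count (fun j => nth 0 s j < v)%N (iota 0 (size s))
        = count (fun x => x < v)%N s.
  by rewrite -[in RHS](mkseq_nth 0%N s) /mkseq count_map.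
rewrite (permP ps) -(@subnKC v.-1 (size s)); last first.
  by apply: leq_trans (leq_pred v) _; rewrite -ltnS -add1n.
rewrite iotaD count_cat.
have /eqP -> : count (fun x => x < v)%N (iota 1 v.-1) == size (iota 1 v.-1).
  rewrite -all_count; apply/allP=> x.
  by rewrite mem_iota add1n prednK // => /andP[].
have /eqP -> : count (fun x => x < v)%N (iota (1 + v.-1) (size s - v.-1)) == 0%N.
  rewrite -leqn0 leqNgt -has_count; apply/hasPn=> x.
  by rewrite mem_iota add1n prednK // -leqNgt => /andP[].
by rewrite size_iota addn0 prednK.
Qed.

Lemma contained_refl (pi : seq nat) : contained pi pi.
Proof.
apply/existsP; exists [ffun i => i].
by apply/andP; split; apply/forallP=> r; apply/forallP=> s; rewrite !ffunE //;
  apply/implyP.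
Qed.

Lemma contained_size_eq (sigma pi : seq nat) : is_perm sigma -> is_perm pi ->
  size sigma = size pi -> contained sigma pi -> sigma = pi.
Proof.
move=> psig ppi eqsz /existsP[f /andP[/forallP fmono /forallP fiso]].
have ge_f i (lt_i : (i < size sigma)%N) : (i <= f (Ordinal lt_i))%N.
  elim: i lt_i => // i IHi lt_i; have lt_i' := ltnW lt_i.
  apply: leq_ltn_trans (IHi lt_i') _.
  have := forallP (fmono (Ordinal lt_i')) (Ordinal lt_i).
  by rewrite /= ltnSn.
have le_f k i (lt_i : (i < size sigma)%N) : (i + k.+1 = size sigma)%N ->
  (f (Ordinal lt_i) <= i)%N.
  elim: k i lt_i => [|k IHk] i lt_i def_sz.
    rewrite -ltnS; apply: leq_trans (ltn_ord _) _.
    by rewrite -eqsz -def_sz addn1.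
  have lt_i' : (i.+1 < size sigma)%N by rewrite -def_sz addnS ltnS addnS ltnS leq_addr.
  rewrite -ltnS; apply: leq_trans (IHk _ lt_i' _); last by rewrite addSnnS.
  have := forallP (fmono (Ordinal lt_i)) (Ordinal lt_i').
  by rewrite /= ltnSn.
have f_id i (lt_i : (i < size sigma)%N) : f (Ordinal lt_i) = i :> nat.
  apply/eqP; rewrite eqn_leq ge_f andbT (le_f (size sigma - i.+1)%N) //.
  by rewrite -addSnnS subnKC.
apply: (eq_from_nth (x0 := 0%N)) => // i lt_i.
rewrite (nth_is_perm psig lt_i) (nth_is_perm ppi) -?eqsz //; congr _.+1.
apply: eq_in_count => j; rewrite mem_iota add0n => /= lt_j.
by have /eqP := forallP (fiso (Ordinal lt_j)) (Ordinal lt_i); rewrite !f_id.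
Qed.

Lemma strictly_contained_size (sigma pi : seq nat) :
  is_perm sigma -> is_perm pi -> strictly_contained sigma pi ->
  (size sigma < size pi)%N.
Proof.
move=> psig ppi /andP[le_sp neq]; rewrite ltn_neqAle size_contained // andbT.
by apply: contraNneq neq => eqsz; apply/eqP/contained_size_eq.
Qed.

Lemma mobius_rec_enough (k : nat) (sigma pi : seq nat) :
  is_perm pi -> (size pi <= k)%N -> mobius_rec k sigma pi = mobius sigma pi.
Proof.
rewrite /mobius; have [m] := ubnP (size pi).
elim: m k pi => // m IHm k pi lt_m ppi le_k.
have sz_gt0 : (0 < size pi)%N by case/andP: ppi; case: (pi).
case: k le_k => [|k] le_k; first by rewrite leqNgt sz_gt0 in le_k.
case def_n: (size pi) sz_gt0 => [//|n] _ /=.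
rewrite def_n; case: ifP => // _; case: ifP => // _; congr (- _).
rewrite big_nat_cond [in RHS]big_nat_cond; apply: eq_bigr => l.
rewrite andbT => /andP[l_gt0 _].
rewrite big_seq_cond [in RHS]big_seq_cond; apply: eq_bigr => lam.
rewrite mem_perms // => /and3P[/andP[plam _] _ lt_lp].
have lt_sz := strictly_contained_size plam ppi lt_lp.
have lt_lm : (size lam < m)%N by apply: leq_trans lt_sz _; rewrite -ltnS.
rewrite def_n !ltnS in lt_sz le_k.
by rewrite IHm ?(leq_trans lt_sz) // [RHS]IHm.
Qed.

Lemma mobius_ncontained (sigma pi : seq nat) :
  ~~ contained sigma pi -> mobius sigma pi = 0.
Proof. by rewrite /mobius; case: (size pi) => //= n ->. Qed.

Lemma mobius_id (pi : seq nat) : is_perm pi -> mobius pi pi = 1.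
Proof.
case/andP=> pi_neq0 _; rewrite /mobius.
case def_n: (size pi) => [|n] /=; last by rewrite contained_refl eqxx.
by rewrite -size_eq0 def_n in pi_neq0.
Qed.

Lemma mobius_lt (sigma pi : seq nat) :
  is_perm pi -> strictly_contained sigma pi ->
  mobius sigma pi =
    - \sum_(1 <= n < (size pi).+1)
        \sum_(lambda <- perms n |
                contained sigma lambda && strictly_contained lambda pi)
          mobius sigma lambda.
Proof.
move=> ppi /andP[le_sp neq].
rewrite -(@mobius_rec_enough (size pi).+1) //= le_sp (negPf neq) /=.
congr (- _); rewrite big_nat_cond [in RHS]big_nat_cond; apply: eq_bigr => l.
rewrite andbT => /andP[l_gt0 _].
rewrite big_seq_cond [in RHS]big_seq_cond; apply: eq_bigr => lam.
rewrite mem_perms // => /and3P[/andP[plam _] _ lt_lp].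
by rewrite mobius_rec_enough // ltnW // strictly_contained_size.
Qed.

Lemma balloon2413_is_perm (beta : seq nat) :
  is_perm beta -> is_perm (balloon2413 beta).
Proof.
case/andP=> _ pb; rewrite /is_perm.
have -> : size (balloon2413 beta) = (size beta + 4)%N.
  by rewrite /= size_cat size_map /= !addnS addn0.
rewrite /balloon2413; set n := size beta in pb *.
have eq_iota : iota 1 (n + 4) =
    [:: 1; 2]%N ++ [seq (b + 2)%N | b <- iota 1 n] ++ [:: n + 3; n + 4]%N.
  rewrite -[(n + 4)%N]/(n + (2 + 2))%N addnCA iotaD iotaD /=.
  congr [:: _, _ & _ ++ _]; last by rewrite ?addnS ?addn0 ?add1n.
  by rewrite (eq_map (g := addn 2%N)) -?iotaDl // => x; rewrite addnC.
rewrite eq_iota; apply/permP => a /=.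
rewrite !count_cat /= (permP (perm_map (fun b => (b + 2)%N) pb) a).
set c := count _ _; rewrite !addn0.
by case: (a 1%N) (a 2%N) (a (n + 3)%N) (a (n + 4)%N) => [] [] [] [];
  rewrite ?(addn0, add0n, addn1, add1n, addnS, addSn).
Qed.

(* Main.v *)
Require Import Defs.
From mathcomp Require Import all_boot all_order all_algebra.
From mathcomp Require Import zify ring.

Set Implicit Arguments.
Unset Strict Implicit.
Unset Printing Implicit Defensive.

Import GRing.Theory.

(** Write mu for the Möbius function from 1.  The proof rests on three ideas.

    Corners.  Adding a point in a corner of the bounding box of [s] (bottom
    left, say) multiplies mu by -1, or by 0 when [s] already has a point in
    that corner ([mobius_corner]).  Hence mu sums to 0 over every finite
    down-set that is closed under adding a fixed corner to the permutations
    that lack it: [s] and [corner c s] cancel ([sum_corner_closed]).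

    Below the balloon.  Let pi be the balloon of beta.  A permutation contained
    in pi either avoids one of the four outer points, or is the balloon of some
    gamma contained in beta, possibly empty ([contained_balloonP]).  Deleting
    an outer point of pi leaves its successor (in the cyclic order left, top,
    right, bottom) in a corner; deleting that one frees the next, and so on.
    So pi minus an outer point is beta with three corners added in turn, and
    the permutations of the first kind form a union of four principal ideals.
    Inclusion-exclusion evaluates the sum of mu over this union: all the
    intersections that occur are closed under some corner or reduce to unions
    of smaller ideals, down to the ideal of beta, and the sum is -1 if beta = 1
    and 0 otherwise ([sum_missing_corner]).

    Inversion.  A balloon has no point in a corner, so it lies in one of the
    four ideals only if it is contained in beta.  As mu sums to 0 below pi, the
    sum of mu(balloon gamma) over all gamma contained in beta, the empty one
    included, is [beta = 1] plus the sum of mu over the balloons contained in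
    beta ([sum_balloons_below]).  The balloon of the empty word is 2413, and
    mu(2413) = -3.  So the sum over gamma <= beta of
      mu(balloon gamma) - mu(gamma) - [gamma is a balloon] mu(gamma)
        - 3 [gamma = 1]
    is 0 for every beta, where 2413 counts as a balloon; by induction each term
    is 0 ([mobius_balloon]).  The four cases of the theorem are instances of
    this formula. *)

(** * Containment through standardized subwords *)

Local Open Scope nat_scope.

Definition rank (s : seq nat) (x : nat) : nat := (count (fun y => y < x) s).+1.
(** Two words of distinct numbers are order isomorphic when they have the same
    standardization; on permutations it is the identity ([std_id]). *)
Definition std (s : seq nat) : seq nat := map (rank s) s.

Lemma size_std s : size (std s) = size s.
Proof. exact: size_map. Qed.

Lemma leq_rank s x y : x <= y -> rank s x <= rank s y.
Proof. by move=> le_xy; rewrite ltnS; apply: sub_count => z /leq_trans; apply. Qed.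

Lemma ltn_rank s x y : x \in s -> (rank s x < rank s y) = (x < y).
Proof.
move=> sx; case: (ltnP x y) => [lt_xy|/leq_rank-/(_ s)]; last by rewrite ltnNge => ->.
rewrite /rank ltnS; have -> : count (fun z => z < y) s =
    count (fun z => z < x) s + count (fun z => x <= z < y) s.
  rewrite -count_predUI [X in _ + X](@eq_count _ _ pred0) ?count_pred0 ?addn0.
    by apply: eq_count => z /=; lia.
  by move=> z /=; lia.
rewrite -[X in X < _]addn0 ltn_add2l -has_count.
by apply/hasP; exists x; rewrite // leqnn.
Qed.

Lemma std_map g s : {in s &, {mono g : x y / x < y}} -> std (map g s) = std s.
Proof.
move=> g_mono; rewrite /std -map_comp; apply/eq_in_map => x sx /=.
by rewrite /rank count_map; congr _.+1; apply: eq_in_count => y sy /=; apply: g_mono.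
Qed.

Lemma std_map_subseq (g : nat -> nat) s t :
  {in t &, {mono g : x y / x < y}} -> subseq s t -> std (map g s) = std s.
Proof.
by move=> g_mono /mem_subseq st; apply: std_map => x y /st tx /st; apply: g_mono.
Qed.

Lemma std_is_perm s : s != [::] -> uniq s -> is_perm (std s).
Proof.
move=> s_nil s_uniq; rewrite /is_perm -!size_eq0 size_std size_eq0 s_nil /=.
have std_uniq : uniq (std s).
  rewrite map_inj_in_uniq // => x y sx sy eq_r.
  have := ltn_rank y sx; have := ltn_rank x sy; rewrite eq_r ltnn; lia.
have sub : {subset std s <= iota 1 (size s)}.
  move=> _ /mapP[x sx ->]; rewrite mem_iota add1n ltnS /rank /=.
  have <- : count (fun y => y < x) s + count (fun y => x <= y) s = size s.
    rewrite -(count_predC (fun y => y < x)); congr (_ + _).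
    by apply: eq_count => y /=; rewrite -leqNgt.
  rewrite -addn1 leq_add2l -has_count; apply/hasP; exists x => //.
have sz : size (iota 1 (size s)) <= size (std s) by rewrite size_iota size_std.
have [_ eqm] := uniq_min_size std_uniq sub sz.
by apply: uniq_perm; rewrite ?iota_uniq ?size_std.
Qed.

Lemma is_perm_uniq s : is_perm s -> uniq s.
Proof. by case/andP=> _ ps; rewrite (perm_uniq ps) iota_uniq. Qed.

Lemma is_perm_gt0 s : is_perm s -> 0 < size s.
Proof. by case/andP; case: s. Qed.

Lemma mem_is_perm s x : is_perm s -> (x \in s) = (0 < x <= size s).
Proof. by case/andP=> _ ps; rewrite (perm_mem ps) mem_iota add1n ltnS. Qed.

Lemma std_id s : is_perm s -> std s = s.
Proof.
move=> ps; apply: (@eq_from_nth _ 0); rewrite size_std // => i lt_i.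
rewrite (nth_map 0) // [RHS]nth_is_perm // /rank.
by rewrite -[X in (count _ X).+1](mkseq_nth 0 s) /mkseq count_map.
Qed.

(** The subword [s] is the occurrence of [sigma] in [pi]; this trades the
    index function in the definition of containment for list recursion. *)
Lemma containedP sigma pi : is_perm sigma ->
  reflect (exists2 s, subseq s pi & std s = sigma) (contained sigma pi).
Proof.
move=> psig; apply: (iffP existsP) => [[f /andP[/forallP f_mono /forallP f_iso]] | [s]].
  pose t := [seq val (f i) | i <- enum 'I_(size sigma)].
  have t_sorted : sorted ltn t.
    rewrite /t sorted_map; have := iota_ltn_sorted 0 (size sigma).
    rewrite -val_enum_ord sorted_map; apply: sub_sorted => i j /= lt_ij.
    by have /implyP := forallP (f_mono i) j; apply.
  have size_t : size t = size sigma by rewrite size_map size_enum_ord.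
  have nth_t (i : 'I_(size sigma)) : nth 0 t i = f i.
    by rewrite (nth_map i) ?size_enum_ord // nth_ord_enum.
  have lt_t : {in t, forall j, j < size pi} by move=> _ /mapP[i _ ->] /=.
  clearbody t; exists (map (nth 0 pi) t).
    rewrite -{2}(mkseq_nth 0 pi); apply: map_subseq.
    have -> : t = [seq i <- iota 0 (size pi) | i \in t].
      apply: (irr_sorted_eq ltn_trans ltnn) => // [|i].
        exact/sorted_filter/iota_ltn_sorted/ltn_trans.
      by rewrite mem_filter mem_iota add0n /=; case: (boolP (i \in t)) => // /lt_t ->.
    exact: filter_subseq.
  apply: (@eq_from_nth _ 0); rewrite size_std size_map size_t // => i lt_i.
  rewrite /std !(nth_map 0) ?size_map ?size_t // (nth_is_perm psig lt_i).
  rewrite /rank count_map -{2}(mkseq_nth 0 t) count_map size_t; congr _.+1.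
  apply: eq_in_count => j; rewrite mem_iota add0n => /= lt_j.
  rewrite (nth_t (Ordinal lt_j)) (nth_t (Ordinal lt_i)).
  exact: (eqP (forallP (f_iso (Ordinal lt_j)) (Ordinal lt_i))).
case/subseqP=> m size_m -> def_sig.
pose t := mask m (iota 0 (size pi)).
have def_s : mask m pi = map (nth 0 pi) t.
  by rewrite map_mask -[map _ _]/(mkseq (nth 0 pi) _) mkseq_nth.
have size_t : size t = size sigma by rewrite -def_sig size_std def_s size_map.
have t_sorted : sorted ltn t.
  exact: (subseq_sorted ltn_trans (mask_subseq _ _) (iota_ltn_sorted _ _)).
have lt_t i : i < size sigma -> nth 0 t i < size pi.
  rewrite -size_t => /(mem_nth 0); rewrite /t => /mem_mask.
  by rewrite mem_iota.
exists [ffun i : 'I_(size sigma) => Ordinal (lt_t i (ltn_ord i))].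
apply/andP; split; apply/forallP=> i; apply/forallP=> j; rewrite !ffunE /=.
  apply/implyP=> lt_ij; apply: (sorted_ltn_nth ltn_trans) => //;
    by rewrite inE size_t.
have nth_sig k : k < size sigma ->
    nth 0 sigma k = rank (map (nth 0 pi) t) (nth 0 pi (nth 0 t k)).
  by move=> lt_k; rewrite -def_sig def_s /std !(nth_map 0) ?size_map ?size_t.
rewrite !nth_sig // ltn_rank // map_f // mem_nth ?size_t //.
Qed.

(** Ranking is increasing on the letters of [t], so occurrences in [std t] can
    be read off [t] itself. *)
Lemma containedP_std sigma t : is_perm sigma ->
  reflect (exists2 s, subseq s t & std s = sigma) (contained sigma (std t)).
Proof.
move=> psig; have mono : {in t &, {mono rank t : x y / x < y}}.
  by move=> x y tx _; apply: ltn_rank.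
apply: (iffP (containedP _ psig)) => -[s].
  case/subseqP=> m _ ->; rewrite /std -map_mask.
  rewrite -/(std _) (std_map_subseq (t := t)) ?mask_subseq // => std_m.
  by exists (mask m t) => //; apply: mask_subseq.
move=> st def_sig; exists (map (rank t) s); first exact: map_subseq.
by rewrite (std_map_subseq (t := t)).
Qed.

Lemma contained_trans rho sigma tau : is_perm rho -> is_perm sigma ->
  contained rho sigma -> contained sigma tau -> contained rho tau.
Proof.
move=> prho psig le_rs /(containedP _ psig)[t st def_sig]; move: le_rs.
rewrite -def_sig => /(containedP_std _ prho)[s ss def_rho].
by apply/containedP => //; exists s; rewrite // (subseq_trans ss).
Qed.

Lemma contained1 tau : is_perm tau -> contained [:: 1] tau.
Proof.
move=> ptau; apply/containedP => //; exists [:: head 0 tau].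
  by case: tau ptau => // x t _; rewrite sub1seq mem_head.
by rewrite /std /= /rank /= ltnn.
Qed.

(** * Corner points *)

Definition add_end (left : bool) (x : nat) (s : seq nat) : seq nat :=
  if left then x :: s else rcons s x.

Lemma subseq_add_end h x s t :
  subseq s (add_end h x t) <-> subseq s t \/ exists2 s', subseq s' t & s = add_end h x s'.
Proof.
have cons_case u v : subseq u (x :: v) <->
    subseq u v \/ exists2 u', subseq u' v & u = x :: u'.
  split=> [|[uv|[u' uv ->]]]; last 1 [by rewrite /= eqxx]; last first.
    exact: subseq_trans uv (subseq_cons _ _).
  case: u => [|y u] /=; first by left; apply: sub0seq.
  by case: eqP => [-> uv|_]; [right; exists u | left].
case: h => /=; first exact: cons_case.
rewrite -subseq_rev rev_rcons cons_case subseq_rev.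
split=> -[st|[s' st def_s]]; try by left.
  right; exists (rev s'); first by rewrite -subseq_rev revK.
  by rewrite -rev_cons -def_s revK.
by right; exists (rev s'); rewrite ?def_s ?rev_rcons ?subseq_rev.
Qed.

Lemma perm_add_end h x s : perm_eq (add_end h x s) (x :: s).
Proof. by case: h => //=; rewrite perm_rcons. Qed.

Lemma size_add_end h x s : size (add_end h x s) = (size s).+1.
Proof. exact: perm_size (perm_add_end h x s). Qed.

Lemma add_end_inj h x y s t : add_end h x s = add_end h y t -> x = y /\ s = t.
Proof. by case: h => /= [[-> ->] | /rcons_inj[-> ->]]. Qed.

Lemma map_add_end g h x s : map g (add_end h x s) = add_end h (g x) (map g s).
Proof. by case: h => //=; rewrite map_rcons. Qed.

(** The flags of [c] say whether the new point is leftmost (else rightmost) and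
    topmost (else bottommost): [(true, false)] is the bottom left corner. *)
Definition corner (c : bool * bool) (s : seq nat) : seq nat :=
  add_end c.1 (if c.2 then (size s).+1 else 1) (if c.2 then s else map succn s).

(** The one-point permutation is said to have no corner: then the
    permutations with a corner [c] are exactly the values of [corner c] on
    permutations ([has_cornerP]). *)
Definition has_corner (c : bool * bool) (s : seq nat) : bool :=
  (1 < size s) &&
  ((if c.1 then head 0 s else last 0 s) == (if c.2 then size s else 1)).

Lemma size_corner c s : size (corner c s) = (size s).+1.
Proof. by rewrite size_add_end; case: c.2; rewrite ?size_map. Qed.

Lemma corner_inj c : injective (corner c).
Proof.
move=> s t /add_end_inj[_]; case: c.2 => //; exact/inj_map/succn_inj.
Qed.

Lemma std_add_end c x s : (forall y, y \in s -> if c.2 then y < x else x < y) ->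
  std (add_end c.1 x s) = corner c (std s).
Proof.
move=> x_ext; rewrite /std map_add_end /corner.
have rankE y : rank (add_end c.1 x s) y = (x < y) + rank s y.
  by rewrite /rank (permP (perm_add_end _ _ _)) /= addnS.
have -> : rank (add_end c.1 x s) x = if c.2 then (size (std s)).+1 else 1.
  rewrite rankE ltnn /rank size_std; case: c.2 x_ext => x_ext; congr _.+1.
    by apply/eqP; rewrite -all_count; apply/allP.
  by apply/eqP; rewrite -leqn0 leqNgt -has_count; apply/hasPn=> y /x_ext; lia.
congr (add_end _ _ _); case: c.2 x_ext => x_ext.
  by apply/eq_in_map => y /x_ext lt_yx; rewrite rankE ltnNge ltnW.
by rewrite -map_comp; apply/eq_in_map => y /x_ext /= lt_xy; rewrite rankE lt_xy.
Qed.

(** Inserting 0 instead of shifting all letters up keeps [s] a subword, which is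
    what the analysis of occurrences needs. *)
Lemma cornerE c s : is_perm s ->
  corner c s = std (add_end c.1 (if c.2 then (size s).+1 else 0) s).
Proof.
move=> ps; rewrite std_add_end ?std_id // => y.
by rewrite mem_is_perm //; case: c.2 => /andP[].
Qed.

Lemma corner_is_perm c s : is_perm s -> is_perm (corner c s).
Proof.
move=> ps; rewrite cornerE //; apply: std_is_perm.
  by rewrite -size_eq0 size_add_end.
rewrite (perm_uniq (perm_add_end _ _ _)) /= is_perm_uniq // andbT mem_is_perm //.
by case: c.2; rewrite ?ltnn ?andbF.
Qed.

(** An occurrence of [tau] either avoids the corner point of [corner c rho], or
    uses it, as an extreme point of [tau] in the same corner. *)
Lemma contained_cornerP c tau rho : is_perm tau -> is_perm rho ->
  reflect (contained tau rho \/
           exists2 s, subseq s rho & tau = corner c (std s))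
          (contained tau (corner c rho)).
Proof.
move=> ptau prho; rewrite [corner c rho]cornerE //; set x := if _ then _ else _.
have std_x s : subseq s rho -> std (add_end c.1 x s) = corner c (std s).
  move=> /mem_subseq s_rho; rewrite std_add_end // => y /s_rho.
  by rewrite mem_is_perm // /x; case: c.2 => /andP[].
apply: (iffP (containedP_std _ ptau)).
  case=> s /subseq_add_end[s_rho | [s' s_rho ->]].
  - by move=> def_tau; left; apply/containedP => //; exists s.
  - by rewrite std_x // => <-; right; exists s'.
case.
  case/(containedP _ ptau) => s s_rho def_tau; exists s => //.
  by apply/subseq_add_end; left.
case=> s s_rho ->; exists (add_end c.1 x s); last exact: std_x.
by apply/subseq_add_end; right; exists s.
Qed.

Lemma contained_corner c rho : is_perm rho -> contained rho (corner c rho).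
Proof.
by move=> prho; apply/contained_cornerP => //; left; apply: contained_refl.
Qed.

Lemma contained_cornerW c tau rho : is_perm tau -> is_perm rho ->
  contained tau rho -> contained tau (corner c rho).
Proof. by move=> pt pr le_tr; apply/contained_cornerP => //; left. Qed.

Lemma corner_contained c tau rho : is_perm tau -> is_perm rho ->
  contained (corner c tau) rho -> contained tau rho.
Proof.
move=> pt pr; apply: contained_trans => //; first exact: corner_is_perm.
exact: contained_corner.
Qed.

Lemma contained_corner2 c sigma rho : is_perm sigma -> is_perm rho ->
  contained (corner c sigma) (corner c rho) = contained sigma rho.
Proof.
move=> psig prho; apply/contained_cornerP/idP => //; first exact: corner_is_perm.
  case; first exact: corner_contained.
  by case=> s s_rho /corner_inj def_sig; apply/containedP => //; exists s.
by case/(containedP _ psig) => s s_rho <-; right; exists s.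
Qed.

Lemma has_corner_corner c s : is_perm s -> has_corner c (corner c s).
Proof.
move=> ps; rewrite /has_corner size_corner ltnS is_perm_gt0 //.
by rewrite /corner; case: c => -[] [] //=; rewrite last_rcons.
Qed.

(** If an occurrence of [tau] used the corner point, [tau] would have the corner
    [c] or be 1, and 1 is contained in [rho] anyway. *)
Lemma contained_no_corner c tau rho : is_perm tau -> is_perm rho ->
  ~~ has_corner c tau -> contained tau (corner c rho) = contained tau rho.
Proof.
move=> pt pr no_c; apply/idP/idP; last exact: contained_cornerW.
case/contained_cornerP => // -[s s_rho def_tau]; case: s => [|x s] in s_rho def_tau.
  have -> : tau = [:: 1] by rewrite def_tau /corner; case: c {no_c def_tau} => -[] [].
  exact: contained1.
case/negP: no_c; rewrite def_tau has_corner_corner // std_is_perm //.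
exact/(subseq_uniq s_rho)/is_perm_uniq.
Qed.

Lemma has_cornerP c tau : is_perm tau ->
  reflect (exists2 sigma, is_perm sigma & tau = corner c sigma) (has_corner c tau).
Proof.
move=> pt; apply: (iffP idP) => [|[sigma ps ->]]; last exact: has_corner_corner.
case/andP=> gt1 /eqP.
have [x [s def_tau]] : exists x s, tau = add_end c.1 x s.
  case: c.1; first by case: (tau) gt1 => // x s _; exists x, s.
  by case/lastP: (tau) gt1 => // s x _; exists x, s.
have -> : (if c.1 then head 0 tau else last 0 tau) = x.
  by rewrite def_tau; case: c.1; rewrite //= last_rcons.
move=> def_x; exists (std s).
  have : uniq tau by apply: is_perm_uniq.
  rewrite def_tau (perm_uniq (perm_add_end _ _ _)) /= => /andP[_ s_uniq].
  by apply: std_is_perm => //; move: gt1; rewrite def_tau size_add_end; case: (s).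
rewrite -[LHS]std_id // {1}def_tau std_add_end // => y sy.
have : uniq tau by apply: is_perm_uniq.
rewrite def_tau (perm_uniq (perm_add_end _ _ _)) /= => /andP[x_s _].
have neq_yx : y != x by apply: contraNneq x_s => <-.
have : y \in tau by rewrite def_tau (perm_mem (perm_add_end _ _ _)) inE sy orbT.
by rewrite mem_is_perm //; move: def_x neq_yx; case: c.2 => ->; lia.
Qed.

Definition opposite (c : bool * bool) : bool * bool := (~~ c.1, ~~ c.2).
Definition adjacent (c c' : bool * bool) : bool := (c.1 == c'.1) != (c.2 == c'.2).

(** Two corners on a common side compete for the same extreme position or value,
    whereas opposite corners may coexist. *)
Lemma has_corner_adjacent c c' tau : is_perm tau -> adjacent c c' ->
  has_corner c tau -> ~~ has_corner c' tau.
Proof.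
move=> pt; rewrite /adjacent /has_corner; case: ltnP => //= gt1.
have : head 0 tau != last 0 tau.
  move: (is_perm_uniq pt); case/lastP: tau gt1 {pt} => // -[|y s] x //= _.
  by rewrite mem_rcons inE negb_or last_rcons => /andP[/andP[]].
by case: c c' => -[] [] [[] []] //= neq _ /eqP; move: neq; lia.
Qed.

Lemma corner_opposite c s :
  corner c (corner (opposite c) s) = corner (opposite c) (corner c s).
Proof.
rewrite {1 3}/corner !size_corner /corner; case: c => -[] [] /=;
  by rewrite ?map_rcons ?size_map.
Qed.

Lemma has_corner_opposite c sigma : is_perm sigma -> 1 < size sigma ->
  has_corner c (corner (opposite c) sigma) = has_corner c sigma.
Proof.
move=> ps gt1; rewrite /has_corner size_corner gt1 ltnS ltnW //=.
case: c => -[] [] /=; rewrite /corner /=;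
  case/lastP: sigma {ps} gt1 => // -[|y s] x //= _;
  by rewrite ?map_rcons ?rcons_cons /= ?last_rcons ?size_map ?eqSS.
Qed.

Lemma has_corner_opposite_adjacent c c' sigma : is_perm sigma -> adjacent c c' ->
  has_corner c (corner (opposite c) sigma) -> ~~ has_corner c' sigma.
Proof.
move=> ps cc'; have [gt1|le1 _] := ltnP 1 (size sigma).
  by rewrite has_corner_opposite //; apply: has_corner_adjacent.
by rewrite /has_corner ltnNge le1.
Qed.

(** * Sums over down-sets of permutations *)

Local Open Scope ring_scope.

Local Notation mu := (mobius [:: 1%N]).

(** All permutations of length between 1 and [n]: a finite universe in which the
    sums below can be compared without tracking lengths. *)
Fixpoint perms_upto (n : nat) : seq (seq nat) :=
  if n is n'.+1 then perms_upto n' ++ perms n else [::].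

Lemma mem_perms_upto n s : (s \in perms_upto n) = is_perm s && (size s <= n)%N.
Proof.
elim: n => [|n IHn] /=.
  by rewrite leqn0 in_nil; case: eqP => [/size0nil -> //|]; rewrite andbF.
by rewrite mem_cat IHn mem_perms // -andb_orr [in RHS]leq_eqVlt orbC ltnS.
Qed.

Lemma uniq_perms_upto n : uniq (perms_upto n).
Proof.
elim: n => //= n IHn; rewrite cat_uniq IHn permutations_uniq andbT /=.
apply/hasPn=> s; rewrite mem_perms // mem_perms_upto => /andP[-> /eqP ->].
by rewrite ltnn.
Qed.

Lemma sum_perms_upto n (P : pred (seq nat)) (F : seq nat -> int) :
  \sum_(l <- perms_upto n | P l) F l = \sum_(1 <= k < n.+1) \sum_(l <- perms k | P l) F l.
Proof.
elim: n => [|n IHn]; first by rewrite big_nil big_geq.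
by rewrite big_cat IHn [RHS]big_nat_recr.
Qed.

Lemma eq_sum_perms m n (P Q : pred (seq nat)) (F G : seq nat -> int) :
  (forall s, is_perm s -> (P s && (size s <= m)%N) = (Q s && (size s <= n)%N)) ->
  (forall s, is_perm s -> Q s -> F s = G s) ->
  \sum_(l <- perms_upto m | P l) F l = \sum_(l <- perms_upto n | Q l) G l.
Proof.
move=> eqPQ eqFG; rewrite -big_filter.
rewrite (perm_big [seq l <- perms_upto n | Q l]) /=; last first.
  apply: uniq_perm; rewrite ?filter_uniq ?uniq_perms_upto // => s.
  rewrite !mem_filter !mem_perms_upto.
  by case: (boolP (is_perm s)) => [/eqPQ|]; rewrite ?andbF.
rewrite big_filter big_seq_cond [RHS]big_seq_cond; apply: eq_bigr => s.
by rewrite mem_perms_upto => /andP[/andP[ps _] Qs]; apply: eqFG.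
Qed.

Lemma sum_permsD1 n (P : pred (seq nat)) (F : seq nat -> int) pi :
  is_perm pi -> (size pi <= n)%N -> P pi ->
  \sum_(l <- perms_upto n | P l) F l =
  F pi + \sum_(l <- perms_upto n | P l && (l != pi)) F l.
Proof.
move=> ppi le_n Ppi; rewrite -big_filter (bigD1_seq pi) /= ?big_filter_cond //.
  by rewrite mem_filter Ppi mem_perms_upto ppi.
by rewrite filter_uniq ?uniq_perms_upto.
Qed.

Lemma sum_mobius n pi : is_perm pi -> (size pi <= n)%N ->
  \sum_(l <- perms_upto n | contained l pi) mu l = (pi == [:: 1%N])%:R.
Proof.
move=> ppi le_n.
rewrite (@eq_sum_perms _ (size pi) _ (contained^~ pi) _ (mu)) //; last first.
  move=> s ps; case: (boolP (contained s pi)) => //= /size_contained le_s.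
  by rewrite le_s (leq_trans le_s).
case: (eqVneq pi [:: 1%N]) => [-> | pi_neq1].
  rewrite sum_perms_upto big_nat1 (_ : perms 1 = [:: [:: 1%N]]) // big_cons big_nil.
  by rewrite contained_refl addr0 mobius_id.
rewrite (@sum_permsD1 _ _ _ pi) ?contained_refl //.
rewrite (@mobius_lt _ pi) /strictly_contained ?contained1 1?eq_sym //= -sum_perms_upto.
apply/eqP; rewrite addrC subr_eq0; apply/eqP/eq_sum_perms => // s ps.
by rewrite contained1.
Qed.

(** Möbius inversion in its weakest form, by induction on the length. *)
Lemma inversion_eq0 n (g : seq nat -> int) : 
  (forall pi, is_perm pi -> (size pi <= n)%N -> 
     \sum_(l <- perms_upto n | contained l pi) g l = 0) ->
  forall pi, is_perm pi -> (size pi <= n)%N -> g pi = 0.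
Proof.
move=> sum0 pi; have [m] := ubnP (size pi).
elim: m pi => // m IHm pi lt_m ppi le_n; have := sum0 pi ppi le_n.
rewrite (@sum_permsD1 _ _ _ pi) ?contained_refl // big_seq_cond big1 ?addr0 // => s.
rewrite mem_perms_upto -andbA => /and3P[ps le_s lt_s].
by apply: IHm => //; apply: leq_trans (strictly_contained_size ps ppi lt_s) _.
Qed.

Definition downset (P : pred (seq nat)) : Prop :=
  forall s t, is_perm s -> is_perm t -> contained s t -> P t -> P s.

(** The members of [P] with a corner are the values [corner c l], and those
    without one are in bijection with their images under [corner c]; this groups
    the sum by the image. *)
Lemma sum_downset_corner n c (P : pred (seq nat)) (F : seq nat -> int) :
  downset P -> (forall s, is_perm s -> P s -> size s <= n)%N ->
  (forall s, is_perm s -> P s -> ~~ has_corner c s -> P (corner c s)) ->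
  \sum_(l <- perms_upto n | P l) F l =
  \sum_(l <- perms_upto n | P (corner c l))
     (F (corner c l) + if has_corner c l then 0 else F l).
Proof.
move=> downP boundP closedP.
rewrite (bigID (has_corner c)) /= big_split /=; congr (_ + _); last first.
  rewrite [RHS](eq_bigr (fun l => if ~~ has_corner c l then F l else 0)).
    rewrite -big_mkcondr; apply: eq_sum_perms => // s ps; congr (_ && _).
    case: (boolP (has_corner c s)) => [|no_c]; rewrite ?andbF //= !andbT.
    apply/idP/idP => [Ps|]; first exact: closedP.
    by apply: downP => //; [apply: corner_is_perm | apply: contained_corner].
  by move=> s _; case: ifP.
rewrite -big_filter -[RHS]big_filter -[RHS](big_map (corner c) xpredT).
apply: perm_big; apply: uniq_perm.
- by rewrite filter_uniq ?uniq_perms_upto.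
- by rewrite (map_inj_uniq (@corner_inj c)) filter_uniq ?uniq_perms_upto.
move=> s; rewrite mem_filter mem_perms_upto.
apply/andP/mapP => [[/andP[Ps cs] /andP[ps le_s]] | [t]].
  have [t pt def_s] := has_cornerP c ps cs; exists t => //.
  by rewrite mem_filter mem_perms_upto -def_s Ps pt -ltnS -(size_corner c) -def_s ltnW.
rewrite mem_filter mem_perms_upto => /and3P[Pt pt le_t] ->.
by rewrite Pt has_corner_corner ?corner_is_perm ?boundP ?corner_is_perm.
Qed.

(** The ideal of [corner c pi] is closed under adding the corner [c], so grouping
    its zero sum as in [sum_downset_corner] gives a sum over the ideal of [pi];
    since this vanishes for every [pi], each group vanishes. *)
Lemma mobius_corner c s : is_perm s ->
  mu (corner c s) = if has_corner c s then 0 else - mu s.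
Proof.
move=> ps; pose g l := mu (corner c l) +
  if has_corner c l then 0 else mu l.
suff: g s = 0.
  by move/eqP; rewrite addr_eq0 => /eqP ->; case: ifP; rewrite ?oppr0.
pose n := size s; apply: (@inversion_eq0 n) => // pi ppi le_pi.
have pcpi := corner_is_perm c ppi.
have sum0 : \sum_(l <- perms_upto n.+1 | contained l (corner c pi)) mu l = 0.
  rewrite sum_mobius ?size_corner //; case: eqP => // eq1.
  by have := is_perm_gt0 ppi; rewrite -ltnS -(size_corner c) eq1.
rewrite -[RHS]sum0 [RHS](@sum_downset_corner _ c) //.
- apply: eq_sum_perms => // l pl; rewrite contained_corner2 //.
  case: (boolP (contained l pi)) => //= /size_contained le_l.
  by rewrite !(leq_trans le_l) // ltnW.
- by move=> l t pl pt lt; apply: contained_trans.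
- by move=> l _ /size_contained; rewrite size_corner => /leq_trans; apply.
by move=> l pl + no_c; rewrite contained_no_corner // contained_corner2.
Qed.

Lemma sum_corner_closed n c (P : pred (seq nat)) : downset P -> 
  (forall s, is_perm s -> P s -> size s <= n)%N ->
  (forall s, is_perm s -> P s -> ~~ has_corner c s -> P (corner c s)) ->
  \sum_(l <- perms_upto n | P l) mu l = 0.
Proof.
move=> downP boundP closedP; rewrite (@sum_downset_corner _ c) //.
rewrite big_seq_cond big1 // => s.
rewrite mem_perms_upto => /andP[/andP[ps _] _]; rewrite mobius_corner //.
by case: ifP; rewrite ?addNr ?addr0.
Qed.

Lemma downset_contained rho : downset (contained^~ rho).
Proof. by move=> s t ps pt st; apply: contained_trans. Qed.

Lemma downsetU P Q : downset P -> downset Q -> downset (fun l => P l || Q l).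
Proof.
move=> dP dQ s t ps pt st.
by case/orP=> [/(dP _ _ ps pt st)|/(dQ _ _ ps pt st)] ->; rewrite ?orbT.
Qed.

Lemma downsetI P Q : downset P -> downset Q -> downset (fun l => P l && Q l).
Proof.
by move=> dP dQ s t ps pt st /andP[/(dP _ _ ps pt st)-> /(dQ _ _ ps pt st)->].
Qed.

(** * The permutations that miss an outer point of the balloon *)

Lemma sum_permsU n (P Q : pred (seq nat)) (F : seq nat -> int) :
  \sum_(l <- perms_upto n | P l || Q l) F l =
  \sum_(l <- perms_upto n | P l) F l + \sum_(l <- perms_upto n | Q l) F l
  - \sum_(l <- perms_upto n | P l && Q l) F l.
Proof.
rewrite (big_mkcond P) (big_mkcond Q) (big_mkcond (fun l => P l && Q l)).
rewrite (big_mkcond (fun l => P l || Q l)) -big_split -sumrB /=; apply: eq_bigr => l _.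
by case: (P l) (Q l) => -[]; rewrite /= ?addrK ?subr0 ?addr0 ?add0r.
Qed.

Lemma eq_sum_mobius n (P Q : pred (seq nat)) :
  (forall s, is_perm s -> P s = Q s) ->
  \sum_(l <- perms_upto n | P l) mu l =
  \sum_(l <- perms_upto n | Q l) mu l.
Proof. by move=> eqPQ; apply: eq_sum_perms => // s /eqPQ ->. Qed.

Local Notation TL := (corner (true, true)).
Local Notation BL := (corner (true, false)).
Local Notation TR := (corner (false, true)).
Local Notation BR := (corner (false, false)).
Local Notation hasTL := (has_corner (true, true)).
Local Notation hasBL := (has_corner (true, false)).
Local Notation hasTR := (has_corner (false, true)).
Local Notation hasBR := (has_corner (false, false)).

(** The word 2413 with one outer point erased, around [beta].  Erasing the left
    point 2 puts the top point in the top left corner; without that one, the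
    right point is in the top right corner, and without both, the bottom point
    is in the bottom right corner.  The next three are its rotations. *)
Definition without_left beta := TL (TR (BR beta)).
Definition without_top beta := TR (BR (BL beta)).
Definition without_right beta := BR (BL (TL beta)).
Definition without_bottom beta := BL (TL (TR beta)).

Definition missing_corner beta s :=
  contained s (without_left beta) || contained s (without_top beta)
    || contained s (without_right beta) || contained s (without_bottom beta).

(** Let [s] have no top right corner.  Then [s] is contained in [BR (BL beta)],
    so [TR s] stays in the second ideal.  It stays in the first one because [s]
    is contained in [BR beta]: clear if [s] has no top left corner, and if it
    has one, it cannot use the bottom left corner of [BR (BL beta)]. *)
Lemma without_left_top_closed beta s : is_perm beta -> is_perm s -> ~~ hasTR s ->
  contained s (without_left beta) && contained s (without_top beta) ->
  contained (TR s) (without_left beta) && contained (TR s) (without_top beta).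
Proof.
move=> pb ps noTR /andP[s2 s4].
have pBb := corner_is_perm (false, false) pb.
have pRBb := corner_is_perm (false, true) pBb.
have pLb := corner_is_perm (true, false) pb.
have pBLb := corner_is_perm (false, false) pLb.
have pTRs := corner_is_perm (false, true) ps.
have sBL : contained s (BR (BL beta)) by rewrite -(contained_no_corner _ _ noTR).
rewrite [X in _ && X]contained_corner2 // sBL andbT.
apply: contained_cornerW => //; rewrite contained_corner2 //.
have [hTL|noTL] := boolP (hasTL s); last first.
  move: s2; rewrite /without_left (contained_no_corner _ _ noTL) //.
  by rewrite (contained_no_corner _ _ noTR).
have noBL : ~~ hasBL s by apply: has_corner_adjacent hTL.
have [hBR|noBR] := boolP (hasBR s); last first.
  by move: sBL; rewrite !contained_no_corner.
have [w pw def_s] := has_cornerP _ ps hBR; rewrite def_s in hTL sBL *.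
rewrite contained_corner2 // in sBL; rewrite contained_corner2 //.
rewrite -(contained_no_corner (c := (true, false))) //.
by apply: has_corner_opposite_adjacent pw _ hTL.
Qed.

(** Let [s] have no bottom right corner.  Then [s] is contained in
    [BL (TL beta)], so [BR s] stays in the first ideal, and it suffices to place
    [s] in [BL beta] or [TL beta].  If [s] used both corners of [BL (TL beta)],
    it would be [BL w] with [w] having a top left corner; it would then have
    neither the top left nor the top right corner, and both ideals of the union
    would force it into [BL beta]. *)
Lemma without_right_meet_closed beta s : is_perm beta -> is_perm s -> ~~ hasBR s ->
  contained s (without_right beta) &&
    (contained s (without_left beta) || contained s (without_top beta)) ->
  contained (BR s) (without_right beta) &&
    (contained (BR s) (without_left beta) || contained (BR s) (without_top beta)).
Proof.
move=> pb ps noBR /andP[s3 s24].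
have pBb := corner_is_perm (false, false) pb.
have pRBb := corner_is_perm (false, true) pBb.
have pLb := corner_is_perm (true, false) pb.
have pTb := corner_is_perm (true, true) pb.
have pLTb := corner_is_perm (true, false) pTb.
have pBLb := corner_is_perm (false, false) pLb.
have pBRs := corner_is_perm (false, false) ps.
have sLT : contained s (BL (TL beta)) by rewrite -(contained_no_corner _ _ noBR).
rewrite [X in X && _]contained_corner2 // sLT /=.
have [sb|nsb] := boolP (contained s beta).
  have -> // : contained (BR s) (without_left beta).
  by do 2![apply: contained_cornerW => //]; rewrite contained_corner2.
have [sL|nsL] := boolP (contained s (BL beta)).
  have -> : contained (BR s) (without_top beta); last exact: orbT.
  by apply: contained_cornerW => //; rewrite contained_corner2.
have [hBL|noBL] := boolP (hasBL s); last first.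
  have sT : contained s (TL beta) by rewrite -(contained_no_corner _ _ noBL).
  have [hTL|noTL] := boolP (hasTL s); last first.
    by case/negP: nsb; rewrite -(contained_no_corner _ _ noTL).
  have [w pw def_s] := has_cornerP _ ps hTL; rewrite def_s contained_corner2 // in sT.
  rewrite def_s (corner_opposite (false, false)) /without_left.
  rewrite contained_corner2 ?corner_is_perm //.
  by rewrite contained_cornerW ?contained_corner2 ?corner_is_perm.
exfalso.
have [w pw def_s] := has_cornerP _ ps hBL.
rewrite def_s contained_corner2 // in sLT; rewrite def_s contained_corner2 // in nsL.
have hTL : hasTL w.
  by apply: contraNT nsL => noTL; rewrite -(contained_no_corner _ _ noTL).
have noTR : ~~ hasTR s.
  have noTLw := has_corner_opposite_adjacent (c := (false, true))
    (c' := (true, true)) pw isT.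
  by rewrite def_s; apply/negP => /noTLw; rewrite hTL.
have noTL : ~~ hasTL s by apply: has_corner_adjacent hBL.
case/orP: s24; rewrite /without_left /without_top.
  by rewrite (contained_no_corner _ _ noTL) // (contained_no_corner _ _ noTR) //
    (contained_no_corner _ _ noBR) // (negPf nsb).
by rewrite (contained_no_corner _ _ noTR) // (contained_no_corner _ _ noBR) //
  def_s contained_corner2 // (negPf nsL).
Qed.

(** The three ideals on the right do not share their outermost corner, so this
    intersection is computed, where the previous two were only shown closed: its
    first ideal is closed under [TL], the union of the other two under [BL]. *)
Lemma without_bottom_meet beta s : is_perm beta -> is_perm s ->
  (contained s (without_left beta) || contained s (without_top beta)
     || contained s (without_right beta)) && contained s (without_bottom beta) =
  contained s (TL (TR beta)) ||
    (contained s (BL (TR beta)) || contained s (BL (TL beta))).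
Proof.
move=> pb ps.
have pBb := corner_is_perm (false, false) pb.
have pRBb := corner_is_perm (false, true) pBb.
have pLb := corner_is_perm (true, false) pb.
have pTb := corner_is_perm (true, true) pb.
have pRb := corner_is_perm (false, true) pb.
have pTRb := corner_is_perm (true, true) pRb.
have pLRb := corner_is_perm (true, false) pRb.
have pLTb := corner_is_perm (true, false) pTb.
have pBLb := corner_is_perm (false, false) pLb.
have up c x y : is_perm x -> is_perm y -> contained x y ->
  contained (corner c x) (corner c y) by move=> px py; rewrite contained_corner2.
have tr t u : is_perm t -> contained t u -> contained s t -> contained s u.
  by move=> pt tu st; apply: contained_trans tu.
apply/idP/idP; last first.
  case/or3P => [sTR|sLR|sLT].
  - have -> : contained s (without_left beta).
      by apply: (tr) sTR => //; do 2![apply: (up) => //]; apply: contained_corner.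
    by apply: (tr) sTR => //; apply: contained_corner.
  - apply/andP; split; last first.
      by apply: (tr) sLR => //; apply: (up) => //; apply: contained_corner.
    suff -> : contained s (without_top beta) by rewrite orbT.
    apply: (tr) sLR => //; rewrite (corner_opposite (true, false)).
    by apply: (up) => //; apply: contained_corner.
  apply/andP; split; last first.
    by apply: (tr) sLT => //; do 2![apply: (up) => //]; apply: contained_corner.
  by apply/orP; right; apply: (tr) sLT => //; apply: contained_corner.
case/andP=> s234 s1.
have [//|nsTR] := boolP (contained s (TL (TR beta))).
have hBL : hasBL s.
  by apply: contraNT nsTR => noBL; rewrite -(contained_no_corner _ _ noBL).
have noTL : ~~ hasTL s by apply: has_corner_adjacent hBL.
have noBR : ~~ hasBR s by apply: has_corner_adjacent hBL.
rewrite /= orbC; have [//|nsLT] := boolP (contained s (BL (TL beta))).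
rewrite /without_right (contained_no_corner _ _ noBR) // (negPf nsLT) orbF in s234.
have [w pw def_s] := has_cornerP _ ps hBL.
rewrite def_s contained_corner2 // in s1.
rewrite def_s contained_corner2 // in nsLT; rewrite def_s /= contained_corner2 //.
have [hTL|noTL'] := boolP (hasTL w); last by rewrite -(contained_no_corner _ _ noTL').
have noTR : ~~ hasTR s.
  have noTLw := has_corner_opposite_adjacent (c := (false, true))
    (c' := (true, true)) pw isT.
  by rewrite def_s; apply/negP => /noTLw; rewrite hTL.
case/orP: s234; rewrite /without_left /without_top.
  rewrite (contained_no_corner _ _ noTL) // (contained_no_corner _ _ noTR) //.
  rewrite (contained_no_corner _ _ noBR) // => sb.
  by case/negP: nsTR; do 2![apply: contained_cornerW => //].
rewrite (contained_no_corner _ _ noTR) // (contained_no_corner _ _ noBR) // => sb.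
rewrite def_s contained_corner2 // in sb; exact: contained_cornerW.
Qed.

Lemma two_corners_meet beta s : is_perm beta -> is_perm s ->
  contained s (TL (TR beta)) &&
    (contained s (BL (TR beta)) || contained s (BL (TL beta))) =
  contained s (TR beta) || contained s (TL beta).
Proof.
move=> pb ps.
have pTb := corner_is_perm (true, true) pb.
have pRb := corner_is_perm (false, true) pb.
have [sR|nsR] /= := boolP (contained s (TR beta)).
  by rewrite !(contained_cornerW _ _ _ sR).
have [sT|nsT] := boolP (contained s (TL beta)).
  rewrite [X in _ || X]contained_cornerW // orbT andbT.
  apply: contained_trans sT _ => //; rewrite contained_corner2 //.
  exact: contained_corner.
apply/negP => /andP[sTR /orP sL].
have hTL : hasTL s.
  by apply: contraNT nsR => noTL; rewrite -(contained_no_corner _ _ noTL).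
have noBL : ~~ hasBL s by apply: has_corner_adjacent hTL.
by case: sL; rewrite contained_no_corner // ?(negPf nsR) ?(negPf nsT).
Qed.

Lemma one_corner_meet beta s : is_perm beta -> is_perm s ->
  contained s (TR beta) && contained s (TL beta) = contained s beta.
Proof.
move=> pb ps; apply/andP/idP => [[sR sT]|sb]; last by rewrite !contained_cornerW.
have [hTL|noTL] := boolP (hasTL s); last by rewrite -(contained_no_corner _ _ noTL).
by rewrite -(contained_no_corner (c := (false, true))) //; apply: has_corner_adjacent hTL.
Qed.

Lemma sum_corner_ideal n c rho : is_perm rho -> (size rho < n)%N ->
  \sum_(l <- perms_upto n | contained l (corner c rho)) mu l = 0.
Proof.
move=> pr lt_n; rewrite sum_mobius ?size_corner ?corner_is_perm //.
case: eqP => // /(congr1 size) /eqP; rewrite size_corner eqSS size_eq0.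
by case/andP: pr => /negPf->.
Qed.

(** Inclusion-exclusion adding the four ideals one at a time, then the three
    ideals of [without_bottom_meet], then two; the only sum that may be nonzero
    is the one over the ideal of [beta]. *)
Lemma sum_missing_corner beta n : is_perm beta -> (size beta + 3 <= n)%N ->
  \sum_(l <- perms_upto n | missing_corner beta l) mu l = - (beta == [:: 1%N])%:R.
Proof.
rewrite addn3 => pb le_n.
have pc c x : is_perm x -> is_perm (corner c x) by apply: corner_is_perm.
have le3 c c' c'' s :
    contained s (corner c (corner c' (corner c'' beta))) -> (size s <= n)%N.
  by move/size_contained; rewrite !size_corner => /leq_trans; apply.
have lt2 c c' : (size (corner c (corner c' beta)) < n)%N.
  by rewrite !size_corner.
have lt1 c : (size (corner c beta) < n)%N by rewrite size_corner ltnW.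
have lt0 : (size beta < n)%N by do 2!apply: ltnW.
have sum_LT : \sum_(l <- perms_upto n |
    contained l (without_left beta) && contained l (without_top beta)) mu l = 0.
  apply: (@sum_corner_closed _ (false, true)).
  - by apply: downsetI; apply: downset_contained.
  - by move=> s ps /andP[/le3 ->].
  - by move=> s ps ? ?; apply: without_left_top_closed.
have sum_R : \sum_(l <- perms_upto n |
    (contained l (without_left beta) || contained l (without_top beta))
    && contained l (without_right beta)) mu l = 0.
  apply: (@sum_corner_closed _ (false, false)).
  - by apply: downsetI; [apply: downsetU|]; apply: downset_contained.
  - by move=> s ps /andP[_ /le3 ->].
  - move=> s ps + no; rewrite ![_ && contained _ (without_right _)]andbC.
    exact: without_right_meet_closed.
have sum_BL : \sum_(l <- perms_upto n |
    contained l (BL (TR beta)) || contained l (BL (TL beta))) mu l = 0.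
  apply: (@sum_corner_closed _ (true, false)).
  - by apply: downsetU; apply: downset_contained.
  - move=> s ps /orP[] /size_contained; rewrite !size_corner => /leq_trans; apply;
      exact: ltnW.
  - move=> s ps + no; rewrite !(contained_no_corner _ _ no) ?pc //.
    by rewrite !contained_corner2 ?pc.
rewrite /missing_corner sum_permsU.
rewrite (eq_sum_mobius _ (fun s => @without_bottom_meet beta s pb)).
rewrite sum_permsU sum_R sum_permsU sum_LT.
rewrite /without_left /without_top /without_right /without_bottom.
rewrite !sum_corner_ideal ?lt2 ?lt1 ?pc //.
rewrite sum_permsU sum_BL (eq_sum_mobius _ (fun s => @two_corners_meet beta s pb)).
rewrite sum_permsU (eq_sum_mobius _ (fun s => @one_corner_meet beta s pb)).
by rewrite (@sum_mobius _ beta) ?(ltnW lt0) // !sum_corner_ideal ?lt1 ?lt0 ?pc //; ring.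
Qed.

(** * Balloons *)

Lemma size_balloon s : size (balloon2413 s) = (size s + 4)%N.
Proof. by rewrite /= size_cat size_map /= !addnS addn0. Qed.

Lemma balloon_inj : injective balloon2413.
Proof.
move=> s t eq_st; have := congr1 size eq_st; rewrite !size_balloon => /addIn eq_sz.
move: eq_st => /(congr1 (drop 2)) /=; rewrite !drop0 => /eqP.
rewrite eqseq_cat ?size_map // => /andP[/eqP eq_map _].
by apply: (inj_map (f := addn^~ 2%N)) => // x y /addIn.
Qed.

Lemma std_balloon (s : seq nat) a b c d : (forall y, y \in s -> a < y < d)%N ->
  (c < a < d)%N -> (d < b)%N ->
  std ([:: a; b] ++ s ++ [:: c; d]) = balloon2413 (std s).
Proof.
move=> s_ad c_ad lt_db; set t := _ ++ _.
have rankE y : rank t y = ((a < y) + (b < y) + (c < y) + (d < y) + rank s y)%N.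
  by rewrite /rank /t /= count_cat /=; lia.
have s_d : count (fun y => y < d)%N s = size s.
  by apply/eqP; rewrite -all_count; apply/allP => y /s_ad /andP[].
have s_b : count (fun y => y < b)%N s = size s.
  by apply/eqP; rewrite -all_count; apply/allP => y /s_ad /andP[_ /ltn_trans]; apply.
have s_le x : (x <= a)%N -> count (fun y => y < x)%N s = 0%N.
  move=> le_xa; apply/eqP; rewrite -leqn0 leqNgt -has_count.
  by apply/hasPn=> y /s_ad; lia.
rewrite /std {1}/t !map_cat /= /balloon2413 size_map -map_comp.
have rank_s : [seq rank t y | y <- s] = [seq ((fun b => b + 2) \o rank s) y | y <- s]%N.
  by apply/eq_in_map => y /s_ad y_ad /=; rewrite rankE; lia.
rewrite rank_s; congr [:: _, _ & _ ++ [:: _; _]];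
  by rewrite rankE /rank ?s_d ?s_b ?s_le; lia.
Qed.

Lemma balloon_add_end beta : balloon2413 beta =
  add_end true 2%N (add_end true (size beta + 4)%N (add_end false (size beta + 3)%N
    (add_end false 1%N [seq (b + 2)%N | b <- beta]))).
Proof. by rewrite /balloon2413 /= -!cats1 -catA. Qed.

(** An occurrence that uses all four outer points is the balloon of the pattern
    of its other letters, with [s] possibly empty. *)
Lemma contained_balloonP tau beta : is_perm tau -> is_perm beta ->
  reflect (missing_corner beta tau \/
           exists2 s, subseq s beta & tau = balloon2413 (std s))
          (contained tau (balloon2413 beta)).
Proof.
move=> pt pb; rewrite /missing_corner.
(* The block of [beta] inside the balloon. *)
set n := size beta; pose u := [seq (b + 2)%N | b <- beta].
have u_mem y : y \in u -> (2 < y < n + 3)%N.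
  by case/mapP=> x; rewrite mem_is_perm // => x_le ->; rewrite /n; lia.
have std_u : std u = beta by rewrite std_map ?std_id // => x y _ _ /=; lia.
have u_lt x : (n + 2 < x)%N -> all (fun y => y < x)%N u.
  by move=> lt_x; apply/allP => y /u_mem; lia.
have u_gt x : (x <= 2)%N -> all (fun y => x < y)%N u.
  by move=> le_x; apply/allP => y /u_mem; lia.
have stdE c x s : all (fun y => if c.2 then y < x else x < y)%N s ->
    std (add_end c.1 x s) = corner c (std s).
  by move=> /allP; apply: std_add_end.
(* The outer letters that remain are listed in the order in which they are
   extreme, outermost first, as required by [stdE]. *)
have def_left : without_left beta =
    std (add_end true (n + 4)%N (add_end false (n + 3)%N (add_end false 1%N u))).
  rewrite (stdE (true, true)) 1?(stdE (false, true)) 1?(stdE (false, false)) ?std_u //=;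
    by rewrite ?all_rcons /= ?u_lt ?u_gt ?andbT //; lia.
have def_top : without_top beta =
    std (add_end false (n + 3)%N (add_end false 1%N (add_end true 2%N u))).
  rewrite (stdE (false, true)) 1?(stdE (false, false)) 1?(stdE (true, false)) ?std_u //=;
    by rewrite ?all_rcons /= ?u_lt ?u_gt ?andbT //; lia.
have def_right : without_right beta =
    std (add_end false 1%N (add_end true 2%N (add_end true (n + 4)%N u))).
  rewrite (stdE (false, false)) 1?(stdE (true, false)) 1?(stdE (true, true)) ?std_u //=;
    by rewrite ?all_rcons /= ?u_lt ?u_gt ?andbT //; lia.
have def_bottom : without_bottom beta =
    std (add_end true 2%N (add_end true (n + 4)%N (add_end false (n + 3)%N u))).
  rewrite (stdE (true, false)) 1?(stdE (true, true)) 1?(stdE (false, true)) ?std_u //=;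
    by rewrite ?all_rcons /= ?u_lt ?u_gt ?andbT //; lia.
have subW h x s t : subseq s t -> subseq s (add_end h x t).
  by move=> st; apply/subseq_add_end; left.
have subC h x s t : subseq s t -> subseq (add_end h x s) (add_end h x t).
  by move=> st; apply/subseq_add_end; right; exists s.
have in_std t : subseq t (balloon2413 beta) ->
    contained tau (std t) -> contained tau (balloon2413 beta).
  move=> t_b /(containedP_std _ pt)[s st def_tau].
  by apply/containedP => //; exists s => //; apply: subseq_trans t_b.
have in_without t s : subseq s t -> std s = tau -> contained tau (std t).
  by move=> st def_tau; apply/containedP_std => //; exists s.
have balE s : subseq s beta ->
    std (add_end true 2%N (add_end true (n + 4)%N (add_end false (n + 3)%N
      (add_end false 1%N [seq (b + 2)%N | b <- s])))) = balloon2413 (std s).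
  move=> s_b; rewrite /= -!cats1 -catA.
  rewrite -[std s](std_map (g := addn^~ 2%N)); last by move=> x y _ _ /=; lia.
  apply: (@std_balloon _ 2 (n + 4) 1 (n + 3)); try lia.
  by move=> y y_s; apply: u_mem; apply: (mem_subseq (map_subseq _ s_b)).
apply: (iffP idP).
  case/(containedP _ pt) => s; rewrite balloon_add_end -/n -/u => s_b def_tau.
  case/subseq_add_end: s_b def_tau => [s_b|[s1 s_b ->]] def_tau.
    by left; rewrite def_left (in_without _ _ s_b).
  case/subseq_add_end: s_b def_tau => [s_b|[s2 s_b ->]] def_tau.
    left; have -> : contained tau (without_top beta); last by rewrite orbT.
    rewrite def_top; apply: (in_without _ (add_end true 2%N s1)) def_tau.
    exact: (subC true).
  case/subseq_add_end: s_b def_tau => [s_b|[s3 s_b ->]] def_tau.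
    left; have -> : contained tau (without_right beta); last by rewrite orbT.
    rewrite def_right; apply: (in_without _ (add_end true 2%N
      (add_end true (n + 4)%N s2))) def_tau.
    by do 2!apply: (subC true).
  case/subseq_add_end: s_b def_tau => [s_b|[s4 s_b ->]] def_tau.
    left; have -> : contained tau (without_bottom beta); last by rewrite orbT.
    rewrite def_bottom; apply: (in_without _ (add_end true 2%N
      (add_end true (n + 4)%N (add_end false (n + 3)%N s3)))) def_tau.
    by do 2!apply: (subC true); apply: (subC false).
  right; case/subseqP: s_b def_tau => m _ ->; rewrite -map_mask => def_tau.
  by exists (mask m beta); rewrite ?mask_subseq // -def_tau balE ?mask_subseq.
case=> [|[s s_b def_tau]]; last first.
  apply/containedP => //.
  exists (add_end true 2%N (add_end true (n + 4)%N (add_end false (n + 3)%N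
    (add_end false 1%N [seq (b + 2)%N | b <- s])))); last by rewrite balE.
  rewrite balloon_add_end; do 2!apply: (subC true); do 2!apply: (subC false).
  exact: map_subseq.
rewrite /missing_corner def_bottom def_left def_right def_top.
case/orP=> [/orP[/orP[]|]|]; apply: in_std; rewrite balloon_add_end -/n -/u.
- exact: (subW true).
- apply: (subC true 2%N (add_end false (n + 3)%N (add_end false 1%N u))).
  exact: (subW true).
- apply: (subC true 2%N (add_end true (n + 4)%N (add_end false 1%N u))).
  by apply: (subC true); apply: (subW false).
- by do 2!apply: (subC true); apply: (subC false); apply: (subW false).
Qed.

(** The first letter is 2 and the last one is second largest. *)
Lemma has_corner_balloon c s : ~~ has_corner c (balloon2413 s).
Proof.
rewrite /has_corner size_balloon /balloon2413 /= last_cat /= negb_and.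
by case: c => -[] [] /=; lia.
Qed.

Lemma balloon2413_perm s : (s == [::]) || is_perm s -> is_perm (balloon2413 s).
Proof. by case: eqP => [->|_] // /balloon2413_is_perm. Qed.

Lemma missing_corner_balloon beta s : is_perm beta -> (s == [::]) || is_perm s ->
  missing_corner beta (balloon2413 s) = contained (balloon2413 s) beta.
Proof.
move=> pb /balloon2413_perm ps.
rewrite /missing_corner /without_bottom /without_left /without_right /without_top.
by rewrite !contained_no_corner ?has_corner_balloon ?corner_is_perm // !orbb.
Qed.

Lemma contained_balloon beta : is_perm beta -> contained beta (balloon2413 beta).
Proof.
move=> pb; apply/contained_balloonP => //; left; rewrite /missing_corner.
by rewrite !contained_cornerW ?corner_is_perm ?contained_refl.
Qed.

(** Balloons together with 2413, the balloon of the empty word. *)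
Definition balloon_shaped (s : seq nat) : bool :=
  s \in [seq balloon2413 t | t <- perms (size s - 4)].

Lemma balloon_shapedP s :
  reflect (exists2 t, (t == [::]) || is_perm t & s = balloon2413 t) (balloon_shaped s).
Proof.
apply: (iffP mapP) => [[t pt def_s]|[t pt ->]]; exists t => //.
  case: (posnP (size s - 4)) => [eq0|gt0].
    by move: pt; rewrite eq0 inE => ->.
  by move: pt; rewrite mem_perms // => /andP[-> _]; rewrite orbT.
rewrite size_balloon addnK; case: eqP pt => [-> //|_] /= pt.
by rewrite mem_perms ?pt ?eqxx // is_perm_gt0.
Qed.

(** Below the balloon of [beta], mu sums to 0; by [sum_missing_corner] the sum is
    [- (beta == 1)] over the permutations that miss an outer point, so it is
    [beta == 1] over the balloons not contained in [beta].  Adding the balloons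
    contained in [beta] to both sides makes the index set on the left the ideal
    of [beta]. *)
Lemma sum_balloons_below beta n : is_perm beta -> (size beta <= n)%N ->
  \sum_(s <- [::] :: perms_upto n | (s == [::]) || contained s beta) mu (balloon2413 s)
  = (beta == [:: 1%N])%:R +
    \sum_(s <- perms_upto n | contained s beta && balloon_shaped s) mu s.
Proof.
move=> pb le_n; have pB := balloon2413_is_perm pb.
have := @sum_mobius (n + 4) _ pB; rewrite size_balloon leq_add2r => /(_ le_n).
rewrite (bigID (missing_corner beta)) /=.
rewrite (@eq_sum_mobius _ _ (missing_corner beta)) => [|s ps]; last first.
  by apply/andb_idl => ?; apply/contained_balloonP => //; left.
rewrite sum_missing_corner //; last by rewrite leq_add.
move/eqP; rewrite addrC subr_eq0 => /eqP sum_new.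
(* The balloons not contained in [beta] are exactly what lies below the balloon
   of [beta] outside the four ideals. *)
rewrite (bigID (fun s => contained (balloon2413 s) beta)) /= addrC; congr (_ + _).
  rewrite -sum_new -big_filter -[RHS]big_filter -[LHS](big_map balloon2413 xpredT).
  apply: perm_big; apply: uniq_perm.
  - rewrite (map_inj_uniq balloon_inj) filter_uniq //= uniq_perms_upto andbT.
    by rewrite mem_perms_upto.
  - by rewrite filter_uniq ?uniq_perms_upto.
  move=> s; rewrite mem_filter mem_perms_upto; apply/mapP/idP => [[t]|].
    rewrite mem_filter in_cons mem_perms_upto => /andP[/andP[t_b nb] t_n] ->.
    have pt : (t == [::]) || is_perm t by case: eqP t_n => //= _ /andP[].
    rewrite missing_corner_balloon // nb balloon2413_perm // size_balloon leq_add2r.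
    have -> : (size t <= n)%N by case: eqP t_n => [->|_ /andP[]].
    rewrite !andbT; apply/contained_balloonP => //; first exact: balloon2413_perm.
    right; case: eqP t_b pt => [-> _ _|_ /= t_b pt].
      by exists [::]; rewrite ?sub0seq.
    by case/(containedP _ pt): t_b => u u_b <-; exists u.
  case/andP=> /andP[s_b s_miss] /andP[ps le_s].
  case/contained_balloonP: s_b => // [|[u u_b def_s]]; first by rewrite (negPf s_miss).
  have pu : (std u == [::]) || is_perm (std u).
    rewrite -size_eq0 size_std size_eq0; case: eqP => // /eqP u_nil.
    exact/std_is_perm/(subseq_uniq u_b)/is_perm_uniq.
  exists (std u) => //; rewrite mem_filter in_cons mem_perms_upto.
  move: s_miss le_s; rewrite def_s missing_corner_balloon // size_balloon leq_add2r.
  move=> -> ->.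
  rewrite !andbT pu andbT; case: eqP pu => //= _ pu.
  by apply/containedP => //; exists u.
rewrite -big_filter -[RHS]big_filter -[LHS](big_map balloon2413 xpredT).
apply: perm_big; apply: uniq_perm.
- rewrite (map_inj_uniq balloon_inj) filter_uniq //= uniq_perms_upto andbT.
  by rewrite mem_perms_upto.
- by rewrite filter_uniq ?uniq_perms_upto.
move=> s; rewrite mem_filter mem_perms_upto; apply/mapP/idP => [[t]|].
  rewrite mem_filter in_cons mem_perms_upto => /andP[/andP[t_b nb] t_n] ->.
  have pt : (t == [::]) || is_perm t by case: eqP t_n => //= _ /andP[].
  rewrite nb balloon2413_perm //= (leq_trans (size_contained nb)) // andbT.
  by apply/balloon_shapedP; exists t.
case/andP=> /andP[s_b /balloon_shapedP[t pt def_s]] /andP[ps le_s]; exists t => //.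
rewrite mem_filter in_cons mem_perms_upto -def_s s_b andbT.
case: eqP pt => //= _ pt; rewrite pt /=; apply/andP; split.
  by apply: contained_trans s_b => //; rewrite def_s; apply: contained_balloon.
by apply: leq_trans le_s; rewrite def_s size_balloon leq_addr.
Qed.

(** Below 2413 lie 1, 12, 21 and the four patterns of length 3 other than 123
    and 321; each of these patterns is a corner added to 12 or 21. *)
Lemma mobius_2413 : mu [:: 2; 4; 1; 3]%N = -3.
Proof.
have := @sum_mobius 4 [:: 2; 4; 1; 3]%N isT isT.
pose L := [:: [:: 2; 4; 1; 3]; [:: 1]; [:: 1; 2]; [:: 2; 1]; [:: 1; 3; 2];
  [:: 2; 1; 3]; [:: 2; 3; 1]; [:: 3; 1; 2]]%N.
rewrite -big_filter (perm_big L); last first.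
  apply: uniq_perm; rewrite ?filter_uniq ?uniq_perms_upto // => s.
  rewrite mem_filter mem_perms_upto; apply/andP/idP => [[s_b /andP[ps le_s]]|s_L].
    case/(containedP _ ps): s_b => t /subseqP[m sz_m ->] def_s.
    have s_nil : s != [::] by case/andP: ps.
    move: s_nil; rewrite -def_s {def_s}.
    by case: m sz_m => // -[] [|[] [|[] [|[] [|? ?]]]].
  have [ps le_s] : is_perm s /\ (size s <= 4)%N.
    move: s_L; rewrite !inE.
    by do 7?[case/predU1P => [-> //|]]; move/eqP->.
  split; last by rewrite ps.
  apply/containedP => //; move: s_L; rewrite !inE.
  case/predU1P => [->|]; first by exists [:: 2; 4; 1; 3]%N.
  case/predU1P => [->|]; first by exists [:: 2]%N.
  case/predU1P => [->|]; first by exists [:: 2; 4]%N.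
  case/predU1P => [->|]; first by exists [:: 2; 1]%N.
  case/predU1P => [->|]; first by exists [:: 2; 4; 3]%N.
  case/predU1P => [->|]; first by exists [:: 2; 1; 3]%N.
  case/predU1P => [->|]; first by exists [:: 2; 4; 1]%N.
  by move/eqP->; exists [:: 4; 1; 3]%N.
rewrite /L !big_cons big_nil.
rewrite -[[:: 1; 3; 2]%N]/(BL [:: 2; 1]%N) -[[:: 2; 1; 3]%N]/(TR [:: 2; 1]%N).
rewrite -[[:: 2; 3; 1]%N]/(BR [:: 1; 2]%N) -[[:: 3; 1; 2]%N]/(TL [:: 1; 2]%N).
rewrite !mobius_corner // -[[:: 2; 1]%N]/(TL [:: 1]%N) -[[:: 1; 2]%N]/(BL [:: 1]%N).
rewrite !mobius_corner //= mobius_id // => /eqP; rewrite addr_eq0 => /eqP ->.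
by [].
Qed.

(** * The recurrence *)

Lemma mobius_balloon beta : is_perm beta ->
  mu (balloon2413 beta) =
  mu beta + (if balloon_shaped beta then mu beta else 0)
    + (if beta == [:: 1%N] then 3 else 0).
Proof.
move=> pb; pose h s := mu (balloon2413 s) -
  (mu s + (if balloon_shaped s then mu s else 0) + (if s == [:: 1%N] then 3 else 0)).
suff : h beta = 0 by move/eqP; rewrite subr_eq0 => /eqP.
apply: (@inversion_eq0 (size beta) h) => // pi ppi le_pi.
rewrite sumrB 2!big_split /= sum_mobius // -!big_mkcondr /=.
have := sum_balloons_below ppi le_pi; rewrite big_cons /= mobius_2413.
rewrite (@eq_sum_perms _ (size beta) _ (contained^~ pi) _
  (fun s => mu (balloon2413 s))) //.
  (* The 3 at the permutation 1 cancels the term -3 of the empty word. *)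
  move/(canRL (addKr _)) ->.
  rewrite (@sum_permsD1 _ (fun s => contained s pi && (s == [:: 1%N])) _ [:: 1%N])
    ?contained1 ?(leq_trans (is_perm_gt0 ppi)) //.
  rewrite [X in _ + (3 + X)]big1 => [|s /andP[/andP[_ ->] //]]; ring.
by move=> s ps; case: eqP ps => // ->.
Qed.

Theorem theorem16 (beta : seq nat) (beta_perm : is_perm beta) :
  [/\ beta = [:: 1]%N -> mobius [:: 1]%N (balloon2413 beta) = 4,
      beta = [:: 2; 4; 1; 3]%N -> mobius [:: 1]%N (balloon2413 beta) = - 6,
      is_balloon2413 beta ->
        mobius [:: 1]%N (balloon2413 beta) = 2 * mobius [:: 1]%N beta
    & beta <> [:: 1]%N -> beta <> [:: 2; 4; 1; 3]%N -> ~ is_balloon2413 beta ->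
        mobius [:: 1]%N (balloon2413 beta) = mobius [:: 1]%N beta].
Proof.
have mu_b := mobius_balloon beta_perm; split.
- by move=> def_b; rewrite def_b in mu_b *; rewrite mu_b mobius_id.
- by move=> def_b; rewrite def_b in mu_b *; rewrite mu_b mobius_2413.
- case=> g [pg def_b]; rewrite mu_b.
  have -> : balloon_shaped beta by apply/balloon_shapedP; exists g; rewrite ?pg ?orbT.
  by rewrite def_b /=; ring.
move=> /eqP/negPf b1 b2413 not_b; rewrite mu_b b1 addr0.
case: balloon_shapedP => [[g /predU1P[g0|pg] def_b]|]; last by rewrite addr0.
  by case: b2413; rewrite def_b g0.
by case: not_b; exists g.
Qed.
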